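(* Let $(X,(f_n))$ be a complex situation such that $f_m(f_n(x))=f_m(x)$ whenever $m<n$ and both $f_m(f_n(x))$ and $f_m(x)$ are defined. Then $(2^\omega,\mathbb{G}_1)\preceq^{inj}_c(X,A^f)$.
   Context: For a sequence $(f_n)$ of partial functions, $A^f:=\bigcup_n\mathrm{Graph}(f_n)$. A complex situation is a pair $(X,(f_n)_{n\in\omega})$ where $X$ is a nonempty Polish space, each $f_n$ is a partial continuous open map on $X$ whose domain and range are open in $X$, and $\Delta(X)\subseteq\overline{A^f}\setminus A^f$ ($\Delta(X)$ the diagonal). $(X,A)\preceq^{inj}_c(Y,B)$ means there is an injective continuous $h:X\to Y$ with $A\subseteq(h\times h)^{-1}(B)$. Let $\psi:\omega\to 2^{<\omega}$ be the bijection enumerating finite binary sequences by length and then lexicographically. Let $q_0=0$, $q_{n+1}=3\cdot 2^{q_n}$, $t_n:=\psi(n)0^{2^{q_n}-|\psi(n)|}$, $S_n:=\{2^{q_n}j:j\ge1\}$, $\theta_n(k)=k$ if $k\notin S_n$ and $\theta_n(2^{q_n}j)=2^{q_n}(2j+1)$ for $j\ge1$. For $s\in2^{<\omega}$, $N_s=\{\alpha\in 2^\omega:s\subseteq\alpha\}$. Define $g_n:N_{t_n0}\to N_{t_n1}$ by $g_n(\alpha)(k)=1$ if $k=2^{q_n}$ and $g_n(\alpha)(k)=\alpha(\theta_n(k))$ otherwise, and $\mathbb{G}_1:=\bigcup_n\mathrm{Graph}(g_n)$. *)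

(* Defs.v *)
From Stdlib Require Import Reals Lia List Arith.
Import ListNotations.
Open Scope R_scope.

Definition is_metric {X : Type} (d : X -> X -> R) : Prop :=
  (forall x y, 0 <= d x y) /\
  (forall x y, d x y = 0 <-> x = y) /\
  (forall x y, d x y = d y x) /\
  (forall x y z, d x z <= d x y + d y z).

Definition cauchy {X : Type} (d : X -> X -> R) (u : nat -> X) : Prop :=
  forall eps, 0 < eps -> exists N, forall m n, (N <= m)%nat -> (N <= n)%nat -> d (u m) (u n) < eps.

Definition converges_to {X : Type} (d : X -> X -> R) (u : nat -> X) (x : X) : Prop :=
  forall eps, 0 < eps -> exists N, forall n, (N <= n)%nat -> d (u n) x < eps.

Definition complete_metric {X : Type} (d : X -> X -> R) : Prop :=
  forall u, cauchy d u -> exists x, converges_to d u x.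

Definition separable_metric {X : Type} (d : X -> X -> R) : Prop :=
  exists D : nat -> X, forall x eps, 0 < eps -> exists k, d x (D k) < eps.

Definition polish_metric {X : Type} (d : X -> X -> R) : Prop :=
  is_metric d /\ complete_metric d /\ separable_metric d.

Definition is_open {X : Type} (d : X -> X -> R) (U : X -> Prop) : Prop :=
  forall x, U x -> exists r, 0 < r /\ forall y, d x y < r -> U y.

Definition continuous_on {X : Type} (d : X -> X -> R) (D : X -> Prop) (f : X -> X) : Prop :=
  forall x, D x -> forall eps, 0 < eps ->
    exists delta, 0 < delta /\ forall y, D y -> d x y < delta -> d (f x) (f y) < eps.

Definition image {X : Type} (D : X -> Prop) (f : X -> X) : X -> Prop :=
  fun y => exists x, D x /\ f x = y.

(* a partial continuous open map with domain D open and range open in X;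
   since D is open, the open subsets of D are the open U of X with U ⊆ D *)
Definition partial_cont_open {X : Type} (d : X -> X -> R) (D : X -> Prop) (f : X -> X) : Prop :=
  is_open d D /\ is_open d (image D f) /\ continuous_on d D f /\
  (forall U : X -> Prop, is_open d U -> (forall x, U x -> D x) -> is_open d (image U f)).

Definition Af {X : Type} (dom : nat -> X -> Prop) (f : nat -> X -> X) (x y : X) : Prop :=
  exists n, dom n x /\ f n x = y.

(* complex situation: X nonempty Polish, partial continuous open maps,
   and the diagonal lies in closure(A^f) \ A^f (product metric = max metric) *)
Definition complex_situation {X : Type} (d : X -> X -> R)
  (dom : nat -> X -> Prop) (f : nat -> X -> X) : Prop :=
  inhabited X /\ polish_metric d /\
  (forall n, partial_cont_open d (dom n) (f n)) /\
  (forall x, ~ Af dom f x x) /\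
  (forall x eps, 0 < eps -> exists y z, Af dom f y z /\ d x y < eps /\ d x z < eps).

Definition cantor := nat -> bool.

Definition cantor_continuous {X : Type} (d : X -> X -> R) (h : cantor -> X) : Prop :=
  forall a eps, 0 < eps -> exists N, forall b : cantor,
    (forall k, (k < N)%nat -> b k = a k) -> d (h a) (h b) < eps.

Definition extends (a : cantor) (s : list bool) : Prop :=
  forall i, (i < length s)%nat -> a i = nth i s false.

(* psi : omega -> 2^{<omega}, enumeration by length then lexicographically:
   psi n = binary expansion of n+1 with its leading 1 removed
   (psi 0 = [], psi 1 = [0], psi 2 = [1], psi 3 = [0;0], ...) *)
Definition psi (n : nat) : list bool :=
  let L := Nat.log2 (S n) in
  map (fun i => Nat.testbit (S n) (L - 1 - i)) (seq 0 L).

Fixpoint q (n : nat) : nat :=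
  match n with
  | O => 0
  | S m => 3 * 2 ^ q m
  end%nat.

Definition t (n : nat) : list bool :=
  psi n ++ repeat false (2 ^ q n - length (psi n)).

Definition theta (n k : nat) : nat :=
  let p := (2 ^ q n)%nat in
  if (Nat.ltb 0 k && Nat.eqb (k mod p) 0)%bool then (p * (2 * (k / p) + 1))%nat else k.

Definition g (n : nat) (a : cantor) : cantor :=
  fun k => if Nat.eqb k (2 ^ q n) then true else a (theta n k).

(* G_1 = union of the graphs of g_n : N_{t_n 0} -> N_{t_n 1} *)
Definition G1 (a b : cantor) : Prop :=
  exists n, extends a (t n ++ [false]) /\ b = g n a.

(* Main.v *)
Require Import Defs.
From Stdlib Require Import Reals.
From Stdlib Require Import Lra Lia List Arith.
From Stdlib Require Import ClassicalEpsilon FunctionalExtensionality.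
Import ListNotations.
Open Scope R_scope.

(** For [m < n] one has [g m (g n a) = g m a], so among the first [n] maps only the last one
    defined at [a] matters: it gives [a] a parent, and this makes the Cantor space a forest of
    bounded depth. The embedding is a uniform limit of finitely valued maps [h_n] that
    satisfy the edge conditions for the first [n] maps; [h_n a] depends only on the prefixes,
    of length [2 ^ q n], of [a] and its ancestors (the type of [a]). The index [l] of the map
    with [f l (h a) = h (g m a)] may depend on the type, but increases with [m].

    To pass from [h_n] to [h_(n+1)], the types are treated one at a time, parents first.
    Continuity and openness of the [f l] propagate small perturbations through the finite
    forest. A new edge [a -> g n a] starts from equal values [h_n a = h_n (g n a)], which are
    replaced by some [u] and [f N u] close to them with [N] large. Injectivity is obtained in
    the same way: [f l u = f l (f N u)] for [l < N] and [u <> f N u], so no [f l] is injective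
    near a point of its domain. *)

(** * Combinatorics of the maps [g n] *)

Section Combinatorics.
Local Open Scope nat_scope.

Definition agree (k : nat) (a b : cantor) : Prop := forall i, i < k -> a i = b i.

Definition in_dom (m : nat) (a : cantor) : Prop := extends a (t m ++ [false]).

Lemma agree_sym k a b : agree k a b -> agree k b a.
Proof. intros H i Hi; symmetry; auto. Qed.

Lemma agree_mono k l a b : l <= k -> agree k a b -> agree l a b.
Proof. intros Hl H i Hi; apply H; lia. Qed.

(** * Growth of [q] and domains of the maps *)

Lemma q_lt_S n : 2 ^ q n < q (S n).
Proof.
  change (q (S n)) with (3 * 2 ^ q n).
  pose proof (Nat.pow_nonzero 2 (q n)). lia.
Qed.

Lemma q_lt m n : m < n -> q m < q n.
Proof.
  intros Hmn; induction Hmn as [|n Hmn IH];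
    [pose proof (Nat.pow_gt_lin_r 2 (q m)); pose proof (q_lt_S m)
    |pose proof (Nat.pow_gt_lin_r 2 (q n)); pose proof (q_lt_S n)]; lia.
Qed.

Lemma q_ge n : n <= q n.
Proof. induction n; [simpl; lia|]. pose proof (q_lt n (S n)). lia. Qed.

Lemma pow_q_pos n : 0 < 2 ^ q n.
Proof. pose proof (Nat.pow_nonzero 2 (q n)). lia. Qed.

Lemma pow_q_mono m n : m <= n -> 2 ^ q m <= 2 ^ q n.
Proof.
  intros H. apply Nat.pow_le_mono_r; [lia|].
  destruct (Nat.eq_dec m n) as [->|]; [lia|]. pose proof (q_lt m n). lia.
Qed.

Lemma pow_q_split m n : m < n -> exists r, 2 ^ q n = 2 ^ q m * (2 * r).
Proof.
  intros H. exists (2 ^ (q n - q m - 1)).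
  pose proof (q_lt m n H).
  change (2 * 2 ^ (q n - q m - 1)) with (2 ^ 1 * 2 ^ (q n - q m - 1)).
  rewrite <- !Nat.pow_add_r. f_equal. lia.
Qed.

Lemma pow_q_lt m n : m < n -> 2 ^ q m < 2 ^ q n.
Proof. intros H. apply Nat.pow_lt_mono_r; [lia|]. now apply q_lt. Qed.

Lemma length_t n : length (t n) = 2 ^ q n.
Proof.
  unfold t. rewrite length_app, repeat_length.
  enough (length (psi n) <= 2 ^ q n) by lia.
  unfold psi. rewrite length_map, length_seq.
  pose proof (Nat.log2_lt_lin (S n)). pose proof (q_ge n).
  pose proof (Nat.pow_gt_lin_r 2 (q n)). lia.
Qed.

Lemma in_dom_agree m a b : agree (S (2 ^ q m)) a b -> in_dom m a -> in_dom m b.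
Proof.
  intros Hab Ha i Hi. rewrite <- (Ha i Hi). symmetry. apply Hab.
  rewrite length_app, length_t in Hi. simpl length in Hi. lia.
Qed.

Lemma in_dom_agree_lt m n a b : m < n -> agree (2 ^ q n) a b -> in_dom m a -> in_dom m b.
Proof.
  intros Hmn Hab. apply in_dom_agree.
  apply agree_mono with (2 := Hab). now apply pow_q_lt.
Qed.

Lemma in_dom_bit m a : in_dom m a -> a (2 ^ q m) = false.
Proof.
  intros Ha. rewrite (Ha (2 ^ q m)).
  - rewrite app_nth2; rewrite length_t; [|lia]. now rewrite Nat.sub_diag.
  - rewrite length_app, length_t. simpl length. lia.
Qed.

(** * The substitutions [theta n] *)

Lemma theta_cases n k :
  theta n k = k /\ (k = 0 \/ k mod 2 ^ q n <> 0) \/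
  exists j, 1 <= j /\ k = 2 ^ q n * j /\ theta n k = 2 ^ q n * (2 * j + 1).
Proof.
  pose proof (pow_q_pos n) as Hp. unfold theta.
  destruct (Nat.ltb_spec 0 k) as [Hk|Hk]; simpl andb; [|left; lia].
  destruct (Nat.eqb_spec (k mod 2 ^ q n) 0) as [Hm|Hm]; [right|left; auto].
  exists (k / 2 ^ q n).
  assert (Hk' : k = 2 ^ q n * (k / 2 ^ q n)) by now apply Nat.Div0.div_exact.
  repeat split; auto. nia.
Qed.

Lemma mod_mult p j : p <> 0 -> (p * j) mod p = 0.
Proof. intros. rewrite Nat.mul_comm. now apply Nat.Div0.mod_mul. Qed.

Lemma theta_fix n k : (k = 0 \/ k mod 2 ^ q n <> 0) -> theta n k = k.
Proof.
  intros H. destruct (theta_cases n k) as [[? _]|(j & Hj & Hk & _)]; auto.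
  pose proof (pow_q_pos n). destruct H as [H|H]; [nia|].
  exfalso; apply H. rewrite Hk. apply mod_mult. lia.
Qed.

(** The value [theta m k] is zero, not divisible by [2 ^ q m], or an odd multiple of it; hence it is
    never a positive multiple of [2 ^ q n]. *)
Lemma theta_theta m n k : m < n ->
  theta n (theta m k) = theta m k /\ theta m k <> 2 ^ q n.
Proof.
  intros Hmn. destruct (pow_q_split m n Hmn) as [r Hr].
  pose proof (pow_q_pos m) as Hm. pose proof (pow_q_pos n) as Hn.
  assert (Hd : theta m k = 0 \/ theta m k mod 2 ^ q n <> 0).
  { destruct (theta_cases m k) as [[-> [H|H]]|(j & Hj & Hk & ->)]; auto; right; intros H0;
      apply Nat.Div0.div_exact in H0.
    - apply H. rewrite H0, Hr, <- Nat.mul_assoc. apply mod_mult. lia.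
    - revert H0. generalize (2 ^ q m * (2 * j + 1) / 2 ^ q n). intros c H0.
      rewrite Hr, <- !Nat.mul_assoc in H0. apply Nat.mul_cancel_l in H0; lia. }
  split; [now apply theta_fix|]. intros H. destruct Hd as [Hd|Hd]; [lia|].
  apply Hd. rewrite H. apply Nat.Div0.mod_same.
Qed.

Lemma g_prefix n a : agree (2 ^ q n) (g n a) a.
Proof.
  intros k Hk. unfold g. destruct (Nat.eqb_spec k (2 ^ q n)) as [|_]; [lia|].
  rewrite theta_fix; auto. rewrite Nat.mod_small by lia. lia.
Qed.

Lemma g_bit n a : g n a (2 ^ q n) = true.
Proof. unfold g. now rewrite Nat.eqb_refl. Qed.

(** [g m] reads its argument only at the positions [theta m k], and [g n] changes nothing there. *)
Lemma g_g m n a : m < n -> g m (g n a) = g m a.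
Proof.
  intros Hmn. apply functional_extensionality. intros k. unfold g at 1 3.
  destruct (Nat.eqb k (2 ^ q m)); auto.
  destruct (theta_theta m n k Hmn) as [H1 H2]. unfold g.
  destruct (Nat.eqb_spec (theta m k) (2 ^ q n)); [contradiction|]. now rewrite H1.
Qed.

Lemma bounded_below (u : nat -> nat) M : exists B, forall k, k < M -> u k < B.
Proof.
  induction M as [|M [B HB]]; [exists 0; lia|].
  exists (Nat.max B (S (u M))). intros k Hk.
  destruct (Nat.eq_dec k M) as [->|]; [lia|]. specialize (HB k). lia.
Qed.

Lemma g_agree m k : exists l, forall a b, agree l a b -> agree k (g m a) (g m b).
Proof.
  destruct (bounded_below (theta m) k) as [l Hl]. exists l. intros a b H i Hi.
  unfold g. destruct (Nat.eqb i (2 ^ q m)); auto.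
Qed.

(** The first bit is the most significant, so codes of equal length compare lexicographically. *)
Fixpoint code (k : nat) (a : cantor) : nat :=
  match k with
  | 0 => 0
  | S k' => 2 * code k' a + (if a k' then 1 else 0)
  end.

Lemma code_lt k a : code k a < 2 ^ k.
Proof. induction k; simpl; [lia|]. destruct (a k); lia. Qed.

Lemma code_agree k a b : agree k a b <-> code k a = code k b.
Proof.
  induction k as [|k [IH1 IH2]]; [split; [auto|intros _ i Hi; lia]|].
  split; intros H.
  - simpl. rewrite IH1, (H k) by (auto || intros i Hi; apply H; lia). lia.
  - simpl in H. intros i Hi. destruct (Nat.eq_dec i k) as [->|].
    + destruct (a k), (b k); lia || auto.
    + apply IH2; [|lia]. destruct (a k), (b k); lia.
Qed.

Lemma code_lex j k a b : agree j a b -> a j = false -> b j = true -> j < k ->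
  code k a < code k b.
Proof.
  intros Hab Ha Hb Hk. induction Hk as [|k Hk IH]; simpl.
  - apply code_agree in Hab. rewrite Ha, Hb. lia.
  - destruct (a k), (b k); lia.
Qed.

(** The first bit changed by [g m] is the one at [2 ^ q m], which goes from 0 to 1. *)
Lemma code_g_lt m n a : m < n -> in_dom m a -> code (2 ^ q n) a < code (2 ^ q n) (g m a).
Proof.
  intros Hmn Ha. apply code_lex with (2 ^ q m).
  - apply agree_sym, g_prefix.
  - now apply in_dom_bit.
  - apply g_bit.
  - now apply pow_q_lt.
Qed.

(** * Parents and types *)

Fixpoint last_edge (n : nat) (a : cantor) : option nat :=
  match n with
  | 0 => None
  | S m => if excluded_middle_informative (in_dom m a) then Some m else last_edge m a
  end.

Lemma last_edge_some n a m : last_edge n a = Some m -> m < n /\ in_dom m a.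
Proof.
  induction n as [|n IH]; simpl; [discriminate|].
  destruct (excluded_middle_informative (in_dom n a)) as [H|H].
  - injection 1 as <-. auto.
  - intros E. destruct (IH E). auto.
Qed.

Lemma last_edge_max n a k : k < n -> in_dom k a -> exists m, last_edge n a = Some m /\ k <= m.
Proof.
  induction n as [|n IH]; simpl; intros Hk Ha; [lia|].
  destruct (excluded_middle_informative (in_dom n a)) as [H|H].
  - exists n; split; auto; lia.
  - apply IH; auto. destruct (Nat.eq_dec k n) as [->|]; [contradiction|lia].
Qed.

Lemma last_edge_agree n a b : agree (2 ^ q n) a b -> last_edge n a = last_edge n b.
Proof.
  induction n as [|n IH]; cbn [last_edge]; auto. intros H.
  assert (Hn : n < S n) by lia.
  destruct (excluded_middle_informative (in_dom n a)) as [Ha|Ha],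
    (excluded_middle_informative (in_dom n b)) as [Hb|Hb]; auto.
  - exfalso. apply Hb. now apply in_dom_agree_lt with (1 := Hn) (2 := H).
  - exfalso. apply Ha. apply in_dom_agree_lt with (1 := Hn) (a := b); auto. now apply agree_sym.
  - apply IH. apply agree_mono with (2 := H). apply pow_q_mono. lia.
Qed.

(* A number coding, in base [2 ^ 2 ^ q n], the prefixes of length [2 ^ q n] of [a], of its
   parent [g m a] with [last_edge n a = Some m], of the parent of its parent, and so on.
   Parents increase lexicographically, so the fuel [2 ^ 2 ^ q n] reaches the root. *)
Fixpoint type_fuel (n D : nat) (a : cantor) : nat :=
  match D with
  | 0 => code (2 ^ q n) a
  | S D' =>
      code (2 ^ q n) a +
      match last_edge n a with
      | None => 0
      | Some m => 2 ^ 2 ^ q n * S (type_fuel n D' (g m a))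
      end
  end.

Definition type (n : nat) (a : cantor) : nat := type_fuel n (2 ^ 2 ^ q n) a.

(** Passing to a parent costs one unit of fuel and raises the code, which stays below
    [2 ^ 2 ^ q n]. *)
Lemma type_fuel_stable n D a : 2 ^ 2 ^ q n <= D + code (2 ^ q n) a ->
  type_fuel n (S D) a = type_fuel n D a.
Proof.
  revert a; induction D as [|D IH]; intros a H.
  - pose proof (code_lt (2 ^ q n) a). lia.
  - change (type_fuel n (S (S D)) a) with
      (code (2 ^ q n) a + match last_edge n a with None => 0
        | Some m => 2 ^ 2 ^ q n * S (type_fuel n (S D) (g m a)) end).
    change (type_fuel n (S D) a) with
      (code (2 ^ q n) a + match last_edge n a with None => 0
        | Some m => 2 ^ 2 ^ q n * S (type_fuel n D (g m a)) end).
    destruct (last_edge n a) as [m|] eqn:E; auto.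
    rewrite IH; auto.
    destruct (last_edge_some _ _ _ E) as [H1 H2].
    pose proof (code_g_lt m n a H1 H2). lia.
Qed.

Lemma type_eq n a : type n a = code (2 ^ q n) a +
  match last_edge n a with None => 0 | Some m => 2 ^ 2 ^ q n * S (type n (g m a)) end.
Proof.
  unfold type. rewrite <- type_fuel_stable by lia. reflexivity.
Qed.

(** The parent's type forms the higher digits. Numerical order thus lists parents first, which
    supports inductions and numbers the forest. *)
Lemma type_parent_lt n a m : last_edge n a = Some m -> type n (g m a) < type n a.
Proof.
  intros E. rewrite (type_eq n a), E.
  pose proof (Nat.pow_nonzero 2 (2 ^ q n)). nia.
Qed.

Lemma digits_unique P c c' x y : c < P -> c' < P -> c + P * x = c' + P * y -> c = c' /\ x = y.
Proof.
  intros H H' E. destruct (Nat.div_mod_unique P x y c c'); auto; lia.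
Qed.

Lemma type_eq_inv n a b : type n a = type n b ->
  agree (2 ^ q n) a b /\
  forall m, last_edge n a = Some m -> type n (g m a) = type n (g m b).
Proof.
  intros H.
  (* The successor separates a missing parent from a parent of type 0. *)
  set (digits a := match last_edge n a with None => 0 | Some m => S (type n (g m a)) end).
  assert (Hd : forall a, type n a = code (2 ^ q n) a + 2 ^ 2 ^ q n * digits a).
  { intros c. rewrite type_eq. unfold digits. destruct (last_edge n c); lia. }
  rewrite !Hd in H. apply digits_unique in H as [Hab H]; [|apply code_lt..].
  apply code_agree in Hab. split; auto. intros m E. unfold digits in H.
  rewrite (last_edge_agree _ _ _ Hab) in H, E. rewrite E in H. congruence.
Qed.

(** At level [n] both have the same prefix and, by [g_g], the same parent. Hence the ends of a new
    edge start from equal points. *)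
Lemma type_g n a : type n (g n a) = type n a.
Proof.
  rewrite (type_eq n a), (type_eq n (g n a)).
  pose proof (g_prefix n a) as H.
  rewrite (last_edge_agree _ _ _ H). apply code_agree in H. rewrite H.
  destruct (last_edge n a) as [m|] eqn:E; auto.
  apply last_edge_some in E as [E _]. now rewrite g_g.
Qed.

(** Induction along the parents: if the last edge is [n], then [type_g] gives the new parent the
    same type at level [n]; otherwise both levels have the same parent. *)
Lemma type_S n a b : type (S n) a = type (S n) b -> type n a = type n b.
Proof.
  remember (type (S n) a) as N eqn:HN. revert a b HN.
  induction N as [N IH] using lt_wf_ind. intros a b -> H.
  destruct (type_eq_inv _ _ _ H) as [Hab Hp].
  pose proof (last_edge_agree _ _ _ Hab) as HE.
  assert (Hab' : agree (2 ^ q n) a b).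
  { apply agree_mono with (2 := Hab). apply pow_q_mono. lia. }
  assert (IH' : forall m, last_edge (S n) a = Some m -> type n (g m a) = type n (g m b)).
  { intros m E. apply (IH _ (type_parent_lt _ _ _ E)); auto. }
  cbn [last_edge] in HE, IH'.
  destruct (excluded_middle_informative (in_dom n a)) as [Ha|Ha],
    (excluded_middle_informative (in_dom n b)) as [Hb|Hb].
  - rewrite <- (type_g n a), <- (type_g n b). auto.
  - symmetry in HE. apply last_edge_some in HE. lia.
  - apply last_edge_some in HE. lia.
  - rewrite (type_eq n a), (type_eq n b), HE.
    apply code_agree in Hab'. rewrite Hab'.
    destruct (last_edge n b) as [m|]; auto.
Qed.

Lemma type_bounded n : exists B, forall a, type n a < B.
Proof.
  unfold type. generalize (2 ^ 2 ^ q n) at 1 as D. induction D as [|D [B HB]].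
  - exists (2 ^ 2 ^ q n). intros a. apply code_lt.
  - exists (2 ^ 2 ^ q n + 2 ^ 2 ^ q n * S B). intros a. cbn [type_fuel].
    pose proof (code_lt (2 ^ q n) a).
    destruct (last_edge n a) as [m|]; [|lia].
    specialize (HB (g m a)). nia.
Qed.

Lemma g_agree_below n k : exists l, forall m a b, m < n ->
  agree l a b -> agree k (g m a) (g m b).
Proof.
  induction n as [|n [l Hl]]; [exists 0; lia|].
  destruct (g_agree n k) as [l' Hl']. exists (Nat.max l l'). intros m a b Hm H.
  destruct (Nat.eq_dec m n) as [->|].
  - apply Hl'. apply agree_mono with (2 := H). lia.
  - apply Hl; [lia|]. apply agree_mono with (2 := H). lia.
Qed.

Lemma type_locally_constant n : exists l, forall a b, agree l a b -> type n a = type n b.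
Proof.
  unfold type. generalize (2 ^ 2 ^ q n) as D. induction D as [|D [l Hl]].
  - exists (2 ^ q n). intros a b. apply code_agree.
  - destruct (g_agree_below n l) as [l' Hl']. exists (Nat.max l' (2 ^ q n)).
    intros a b H. cbn [type_fuel].
    assert (Hab : agree (2 ^ q n) a b) by (apply agree_mono with (2 := H); lia).
    rewrite (last_edge_agree _ _ _ Hab). apply code_agree in Hab. rewrite Hab.
    destruct (last_edge n b) as [m|] eqn:E; auto.
    rewrite (Hl _ (g m b)); auto. apply Hl'.
    + now apply last_edge_some in E.
    + apply agree_mono with (2 := H). lia.
Qed.

End Combinatorics.
(** * Perturbation of finite configurations *)

Section Situation.
Context {X : Type} (d : X -> X -> R) (dom : nat -> X -> Prop) (f : nat -> X -> X).
Context (Hmet : is_metric d) (Hf : forall n, partial_cont_open d (dom n) (f n)).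
Context (Hirr : forall x, ~ Af dom f x x).
Context (Hdiag : forall x eps, 0 < eps ->
  exists y z, Af dom f y z /\ d x y < eps /\ d x z < eps).
Context (Hcomp : forall m n x, (m < n)%nat ->
  dom n x -> dom m (f n x) -> dom m x -> f m (f n x) = f m x).

Lemma dist_refl x : d x x = 0.
Proof. now apply (proj1 (proj2 Hmet)). Qed.

Lemma dist_sym x y : d x y = d y x.
Proof. apply Hmet. Qed.

Lemma dist_tri x y z : d x z <= d x y + d y z.
Proof. apply Hmet. Qed.

Lemma dist_pos x y : x <> y -> 0 < d x y.
Proof.
  intros H. destruct (proj1 Hmet x y) as [|E]; auto.
  exfalso. apply H. now apply (proj1 (proj2 Hmet)).
Qed.

Lemma continuous_at n x eps : dom n x -> 0 < eps ->
  exists delta, 0 < delta /\ forall y, d x y < delta -> dom n y /\ d (f n x) (f n y) < eps.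
Proof.
  intros Hx He. destruct (Hf n) as (Ho & _ & Hc & _).
  destruct (Ho x Hx) as (r & Hr & Hr'). destruct (Hc x Hx eps He) as (s & Hs & Hs').
  exists (Rmin r s). split; [now apply Rmin_pos|]. intros y Hy.
  pose proof (Rmin_l r s). pose proof (Rmin_r r s).
  assert (dom n y) by (apply Hr'; lra). split; auto. apply Hs'; auto. lra.
Qed.

Lemma open_at n x eps : dom n x -> 0 < eps ->
  exists delta, 0 < delta /\ forall z, d (f n x) z < delta ->
    exists w, d x w < eps /\ dom n w /\ f n w = z.
Proof.
  intros Hx He. destruct (Hf n) as (Ho & _ & _ & Hop).
  destruct (Hop (fun w => d x w < eps /\ dom n w)) with (x := f n x) as (r & Hr & Hr').
  - intros w [Hw Hdw]. destruct (Ho w Hdw) as (r & Hr & Hr').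
    exists (Rmin r (eps - d x w)). split; [apply Rmin_pos; lra|]. intros y Hy.
    pose proof (Rmin_l r (eps - d x w)). pose proof (Rmin_r r (eps - d x w)).
    pose proof (dist_tri x w y). split; [lra|]. apply Hr'. lra.
  - tauto.
  - exists x. rewrite dist_refl. auto.
  - exists r. split; auto. intros z Hz. destruct (Hr' z Hz) as (w & [H1 H2] & H3). eauto.
Qed.

(** Maps are treated one at a time. If the current ball meets the domain of [f B], it is recentred
    at a point [w] there; since [f B w <> w], continuity pushes a small ball around [w] off
    itself. *)
Lemma avoid_small_edges B x eps : 0 < eps ->
  exists x' eps', 0 < eps' /\ (forall u, d x' u < eps' -> d x u < eps) /\
    forall n u, (n < B)%nat -> dom n u -> d x' u < eps' -> d x' (f n u) < eps' -> False.
Proof.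
  intros He. induction B as [|B (v & r & Hr & Hin & Hno)].
  - exists x, eps. repeat split; auto. lia.
  - destruct (classic (exists w, d v w < r /\ dom B w)) as [(w & Hw & Hdw)|Hn].
    + assert (Hp : 0 < d w (f B w)).
      { apply dist_pos. intros E. apply (Hirr w). exists B. now symmetry in E. }
      destruct (continuous_at B w (d w (f B w) / 2)) as (s & Hs & Hs'); auto; [lra|].
      assert (H : exists r', 0 < r' /\ r' <= s /\ r' <= r - d v w /\ r' <= d w (f B w) / 2).
      { exists (Rmin s (Rmin (r - d v w) (d w (f B w) / 2))).
        repeat split; [repeat apply Rmin_pos; lra| | |];
          unfold Rmin; repeat destruct Rle_dec; lra. }
      destruct H as (r' & H0 & H1 & H2 & H3).
      assert (Hin' : forall u, d w u < r' -> d v u < r).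
      { intros u Hu. pose proof (dist_tri v w u). lra. }
      exists w, r'. repeat split; auto.
      intros n u Hn Hdu Hu Hfu. destruct (Nat.eq_dec n B) as [->|].
      * destruct (Hs' u) as [_ Hc]; [lra|].
        pose proof (dist_tri w (f B u) (f B w)). rewrite (dist_sym (f B u)) in H. lra.
      * apply (Hno n u); auto. lia.
    + exists v, r. repeat split; auto.
      intros n u Hnb Hdu Hu Hfu. destruct (Nat.eq_dec n B) as [->|]; [eauto|].
      apply (Hno n u); auto. lia.
Qed.

(** [Hdiag] supplies an edge inside the ball of [avoid_small_edges], and there its index must exceed
    [B]. *)
Lemma edge_near B x eps : 0 < eps ->
  exists N u, (B < N)%nat /\ dom N u /\ d x u < eps /\ d x (f N u) < eps /\ u <> f N u.
Proof.
  intros He. destruct (avoid_small_edges (S B) x eps He) as (v & r & Hr & Hin & Hno).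
  destruct (Hdiag v r Hr) as (u & z & (N & Hu & <-) & H1 & H2).
  exists N, u. repeat split; auto.
  - destruct (Nat.lt_ge_cases B N); auto. exfalso. apply (Hno N u); auto. lia.
  - intros E. apply (Hirr u). exists N. now symmetry in E.
Qed.

(** * Labelled forests of points *)

(* [par] describes a forest on [{0, ..., M-1}]: [par i = Some j] makes [j] the parent of [i],
   and the point at [i] is sent to the point at [j] by the map of index [lab i]. *)
Definition config (M : nat) (par : nat -> option nat) (lab : nat -> nat) (x : nat -> X) : Prop :=
  forall i j, (i < M)%nat -> par i = Some j -> dom (lab i) (x i) /\ f (lab i) (x i) = x j.

Definition upd {A : Type} (u : nat -> A) (k : nat) (v : A) : nat -> A :=
  fun i => if Nat.eq_dec i k then v else u i.

Lemma upd_eq {A} (u : nat -> A) k v : upd u k v k = v.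
Proof. unfold upd. now destruct (Nat.eq_dec k k). Qed.

Lemma upd_neq {A} (u : nat -> A) k v i : i <> k -> upd u k v i = u i.
Proof. unfold upd. now destruct (Nat.eq_dec i k). Qed.

Lemma config_snoc M par lab x l w :
  (forall i j, par i = Some j -> (j < i)%nat) -> config M par lab x ->
  (forall j, par M = Some j -> dom l w /\ f l w = x j) ->
  config (S M) par (upd lab M l) (upd x M w).
Proof.
  intros Hpar Hc HM i j Hi E. pose proof (Hpar _ _ E).
  rewrite (upd_neq x M w j) by lia. destruct (Nat.eq_dec i M) as [->|].
  - rewrite !upd_eq. auto.
  - rewrite !upd_neq by auto. apply Hc; auto. lia.
Qed.

(** A displacement spreads to parents by continuity and to children by openness. The induction
    removes the last vertex, a leaf because parents have smaller numbers. *)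
Lemma config_propagate M par lab x sigma eps :
  (forall i j, par i = Some j -> (j < i)%nat) -> config M par lab x ->
  (sigma < M)%nat -> 0 < eps ->
  exists delta, 0 < delta /\ forall z, d (x sigma) z < delta ->
    exists x', x' sigma = z /\ config M par lab x' /\
      forall i, (i < M)%nat -> d (x i) (x' i) < eps.
Proof.
  intros Hpar. revert sigma eps. induction M as [|M IH]; intros sigma eps Hc Hs He; [lia|].
  assert (Hc' : config M par lab x) by (intros i j Hi; apply Hc; lia).
  assert (Hlab : upd lab M (lab M) = lab).
  { apply functional_extensionality. intros i. unfold upd. destruct (Nat.eq_dec i M); congruence. }
  assert (Hext : forall x' w, config M par lab x' ->
    (forall i, (i < M)%nat -> d (x i) (x' i) < eps) -> d (x M) w < eps ->
    (forall j, par M = Some j -> dom (lab M) w /\ f (lab M) w = x' j) ->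
    config (S M) par lab (upd x' M w) /\
    forall i, (i < S M)%nat -> d (x i) (upd x' M w i) < eps).
  { intros x' w Hx' Hd Hw HM. split.
    - rewrite <- Hlab. now apply config_snoc.
    - intros i Hi. destruct (Nat.eq_dec i M) as [->|]; [now rewrite upd_eq|].
      rewrite upd_neq by auto. apply Hd. lia. }
  destruct (Nat.eq_dec sigma M) as [->|Hne].
  - destruct (par M) as [p|] eqn:E.
    (* The leaf itself moves to [z]: its parent goes to [f (lab M) z] and the rest follows the
       parent. *)
    + destruct (Hc M p) as [Hdom Hval]; auto.
      destruct (IH p eps) as (r & Hr & Hr'); eauto.
      destruct (continuous_at (lab M) (x M) r) as (s & Hs1 & Hs2); auto.
      exists (Rmin s eps). split; [now apply Rmin_pos|]. intros z Hz.
      pose proof (Rmin_l s eps). pose proof (Rmin_r s eps).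
      destruct (Hs2 z) as [Hz1 Hz2]; [lra|]. rewrite Hval in Hz2.
      destruct (Hr' _ Hz2) as (x' & H1 & H2 & H3).
      exists (upd x' M z). split; [apply upd_eq|]. apply Hext; auto; [lra|].
      intros j [= <-]. auto.
    + exists eps. split; auto. intros z Hz. exists (upd x M z). split; [apply upd_eq|].
      apply Hext; auto; [|discriminate]. intros i _. now rewrite dist_refl.
  - destruct (par M) as [p|] eqn:E.
    (* The rest moves first; openness then lifts the new parent to a point near [x M]. *)
    + destruct (Hc M p) as [Hdom Hval]; auto.
      destruct (open_at (lab M) (x M) eps) as (r & Hr & Hr'); auto.
      destruct (IH sigma (Rmin r eps)) as (s & Hs1 & Hs2); auto; [lia|now apply Rmin_pos|].
      exists s. split; auto. intros z Hz. destruct (Hs2 z Hz) as (x' & H1 & H2 & H3).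
      pose proof (Rmin_l r eps). pose proof (Rmin_r r eps).
      destruct (Hr' (x' p)) as (w & Hw1 & Hw2 & Hw3).
      { rewrite Hval. specialize (H3 p (Hpar _ _ E)). lra. }
      exists (upd x' M w). rewrite upd_neq by auto. split; auto. apply Hext; auto.
      * intros i Hi. specialize (H3 i Hi). lra.
      * intros j [= <-]. auto.
    + destruct (IH sigma eps) as (s & Hs1 & Hs2); auto; [lia|].
      exists s. split; auto. intros z Hz. destruct (Hs2 z Hz) as (x' & H1 & H2 & H3).
      exists (upd x' M (x M)). rewrite upd_neq by auto. split; auto. apply Hext; auto.
      * now rewrite dist_refl.
      * discriminate.
Qed.

(** * Adding vertices with distinct points *)

Definition separated (M : nat) (r : R) (x : nat -> X) : Prop :=
  forall i j, (i < M)%nat -> (j < M)%nat -> i <> j -> r < d (x i) (x j).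

Lemma separated_snoc M x r w : 0 < r -> separated M r x ->
  (forall i, (i < M)%nat -> x i <> w) ->
  exists r', 0 < r' /\ separated (S M) r' (upd x M w).
Proof.
  intros Hr Hs Hw.
  assert (H : exists s, 0 < s /\ forall i, (i < M)%nat -> s < d (x i) w).
  { clear Hs. induction M as [|M IH]; [exists 1; split; [lra|lia]|].
    destruct IH as (s & H1 & H2); [intros i Hi; apply Hw; lia|].
    pose proof (dist_pos (x M) w (Hw M (Nat.lt_succ_diag_r M))) as Hp.
    exists (Rmin s (d (x M) w / 2)). split; [apply Rmin_pos; lra|].
    pose proof (Rmin_l s (d (x M) w / 2)). pose proof (Rmin_r s (d (x M) w / 2)).
    intros i Hi. destruct (Nat.eq_dec i M) as [->|]; [lra|].
    specialize (H2 i ltac:(lia)). lra. }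
  destruct H as (s & Hs1 & Hs2). exists (Rmin r s). split; [now apply Rmin_pos|].
  pose proof (Rmin_l r s). pose proof (Rmin_r r s).
  intros i j Hi Hj Hij. destruct (Nat.eq_dec i M) as [->|].
  - rewrite upd_eq, upd_neq, dist_sym by auto. specialize (Hs2 j ltac:(lia)). lra.
  - rewrite (upd_neq _ _ _ i) by auto. destruct (Nat.eq_dec j M) as [->|].
    + rewrite upd_eq. specialize (Hs2 i ltac:(lia)). lra.
    + rewrite upd_neq by auto. specialize (Hs i j ltac:(lia) ltac:(lia) Hij). lra.
Qed.

Lemma separated_at_most_one_near M x r c : separated M r x ->
  exists i0, forall i, (i < M)%nat -> i <> i0 -> r / 2 <= d (x i) c.
Proof.
  intros Hs. destruct (classic (exists i, (i < M)%nat /\ d (x i) c < r / 2)) as [(i0 & H0 & H1)|Hn].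
  - exists i0. intros i Hi Hne. pose proof (Hs i i0 Hi H0 Hne).
    pose proof (dist_tri (x i) c (x i0)). rewrite (dist_sym c) in H2. lra.
  - exists 0%nat. intros i Hi _. destruct (Rlt_le_dec (d (x i) c) (r / 2)); auto.
    exfalso. eauto.
Qed.

(** [y] holds the points of the previous stage and [old] the labels already fixed there; a new edge
    gets a label above the earlier ones. *)
Definition admissible (M : nat) (par old : nat -> option nat) (B : nat) (y : nat -> X) (eps : R)
    (lab : nat -> nat) (x : nat -> X) : Prop :=
  config M par lab x /\
  (forall i, (i < M)%nat -> d (y i) (x i) < eps) /\
  (forall i j, (i < M)%nat -> par i = Some j ->
     match old i with Some l => lab i = l | None => (B < lab i)%nat end).

(** Apart from [i0], points start at least [r / 2] from [c] and move by less than [r / 4], so they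
    miss [w], which is within [r / 4] of [c]. *)
Lemma admissible_snoc M par old B y eps lab x x' r c l w i0 :
  (forall i j, par i = Some j -> (j < i)%nat) ->
  admissible M par old B y (eps / 2) lab x -> 0 < r -> separated M r x ->
  (forall i, (i < M)%nat -> i <> i0 -> r / 2 <= d (x i) c) ->
  config M par lab x' -> (forall i, (i < M)%nat -> d (x i) (x' i) < Rmin (eps / 2) (r / 4)) ->
  d c w < r / 4 -> x' i0 <> w -> d (y M) w < eps ->
  (forall j, par M = Some j -> dom l w /\ f l w = x' j /\
     match old M with Some l' => l = l' | None => (B < l)%nat end) ->
  exists lab x r, admissible (S M) par old B y eps lab x /\ 0 < r /\ separated (S M) r x.
Proof.
  intros Hpar (_ & Hyx & Hlab) Hr Hs Hi0 Hc' Hd Hcw Hw Hyw HM.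
  pose proof (Rmin_l (eps / 2) (r / 4)). pose proof (Rmin_r (eps / 2) (r / 4)).
  destruct (separated_snoc M x' (r / 2) w) as (r' & Hr' & Hs'); [lra| | |].
  - intros i j Hi Hj Hij. pose proof (Hs i j Hi Hj Hij).
    pose proof (Hd i Hi). pose proof (Hd j Hj).
    pose proof (dist_tri (x i) (x' i) (x j)). pose proof (dist_tri (x' i) (x' j) (x j)).
    rewrite (dist_sym (x' j)) in H5. lra.
  - intros i Hi. destruct (Nat.eq_dec i i0) as [->|Hne]; auto. intros E.
    pose proof (Hi0 i Hi Hne). pose proof (Hd i Hi) as H3. rewrite E in H3.
    pose proof (dist_tri (x i) w c). rewrite (dist_sym w) in H2. lra.
  - exists (upd lab M l), (upd x' M w), r'. split; [|auto]. split; [|split].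
    + apply config_snoc; auto. intros j E. destruct (HM j E) as (? & ? & _). auto.
    + intros i Hi. destruct (Nat.eq_dec i M) as [->|]; [now rewrite upd_eq|].
      rewrite upd_neq by auto. pose proof (Hyx i ltac:(lia)). pose proof (Hd i ltac:(lia)).
      pose proof (dist_tri (y i) (x i) (x' i)). lra.
    + intros i j Hi E. destruct (Nat.eq_dec i M) as [->|].
      * rewrite upd_eq. now apply (HM j).
      * rewrite upd_neq by auto. apply (Hlab i j); auto. lia.
Qed.

Lemma avoid_one (u v p : X) : u <> v -> p <> u \/ p <> v.
Proof. intros H. destruct (classic (p = u)) as [->|]; auto. Qed.

(** Parents are placed before children. Half of the tolerance is kept for readjusting earlier points
    when a vertex is added. *)
Lemma config_extend M par old B y eps :
  (forall i j, par i = Some j -> (j < i)%nat) ->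
  (forall i j, (i < M)%nat -> par i = Some j ->
     match old i with Some l => dom l (y i) /\ f l (y i) = y j | None => y i = y j end) ->
  0 < eps ->
  exists lab x r, admissible M par old B y eps lab x /\ 0 < r /\ separated M r x.
Proof.
  intros Hpar. revert eps. induction M as [|M IH]; intros eps Hy He.
  { exists (fun _ => 0%nat), y, 1. repeat split; try lra; try lia; intros i j; lia. }
  assert (IH' : forall e, 0 < e -> e <= eps / 2 -> exists lab x r,
    admissible M par old B y e lab x /\ admissible M par old B y (eps / 2) lab x /\
    0 < r /\ separated M r x).
  { intros e He1 He2.
    destruct (IH e) as (lab & x & r & (H1 & H2 & H3) & Hr & Hs);
      [intros i j Hi; apply Hy; lia|auto|].
    exists lab, x, r. repeat (split; auto).
    intros i Hi. specialize (H2 i Hi). lra. }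
  destruct (par M) as [p|] eqn:E.
  - pose proof (Hpar _ _ E) as Hp. specialize (Hy M p (Nat.lt_succ_diag_r M) E) as HyM.
    destruct (old M) as [l|] eqn:Eo.
    + destruct HyM as [Hdom Hval].
      (* Old edge: the new parent lifts along [f l] to [c] near [y M]. The edge taken near [c] has
         index above [l], so by [Hcomp] its ends have the same image under [f l]. *)
      destruct (open_at l (y M) (eps / 2)) as (s & Hs1 & Hs2); auto; [lra|].
      destruct (IH' (Rmin s (eps / 2))) as (lab & x & r & (_ & Hcl & _) & Hadm & Hr & Hs);
        [apply Rmin_pos; lra|apply Rmin_r|].
      pose proof (Rmin_l s (eps / 2)) as Hmin.
      destruct (Hs2 (x p)) as (c & Hc1 & Hc2 & Hc3).
      { rewrite Hval. specialize (Hcl p Hp). lra. }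
      destruct (config_propagate M par lab x p (Rmin (eps / 2) (r / 4)))
        as (s' & Hs3 & Hs4); auto; [apply Hadm|apply Rmin_pos; lra|].
      destruct (continuous_at l c s') as (s'' & Hs5 & Hs6); auto.
      set (e := Rmin s'' (Rmin (eps / 2) (r / 4))).
      assert (He' : 0 < e /\ e <= s'' /\ e <= eps / 2 /\ e <= r / 4).
      { unfold e. repeat split; [repeat apply Rmin_pos; lra| | |];
          unfold Rmin; repeat destruct Rle_dec; lra. }
      destruct (edge_near l c e) as (N & u & HN & Hu1 & Hu2 & Hu3 & Hu4); [lra|].
      destruct (Hs6 u) as [Hu5 Hu6]; [lra|]. destruct (Hs6 (f N u)) as [Hu7 _]; [lra|].
      pose proof (Hcomp l N u HN Hu1 Hu7 Hu5) as Hfu.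
      rewrite Hc3 in Hu6. destruct (Hs4 _ Hu6) as (x' & Hx1 & Hx2 & Hx3).
      destruct (separated_at_most_one_near M x r c Hs) as [i0 Hi0].
      (* [u] and [f N u] have the same image under [f l], and at least one of them avoids the
         only point of the configuration that could be at that place. *)
      assert (Hw : exists w, x' i0 <> w /\ d c w < e /\ dom l w /\ f l w = f l u).
      { destruct (avoid_one _ _ (x' i0) Hu4); eauto 6. }
      destruct Hw as (w & Hw1 & Hw2 & Hw3 & Hw4).
      apply (admissible_snoc M par old B y eps lab x x' r c l w i0); auto; try lra.
      * pose proof (dist_tri (y M) c w). lra.
      * intros j. rewrite E, Eo. intros [= <-]. rewrite Hx1. auto.
    (* New edge: as [y M = y p], an edge of large index is taken near [x p]; the parent moves to
       [f N u] and [u] is the added point. *)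
    + destruct (IH' (eps / 2)) as (lab & x & r & _ & Hadm & Hr & Hs); [lra..|].
      destruct (config_propagate M par lab x p (Rmin (eps / 2) (r / 4)))
        as (s & Hs1 & Hs2); auto; [apply Hadm|apply Rmin_pos; lra|].
      set (e := Rmin s (Rmin (eps / 2) (r / 4))).
      assert (He' : 0 < e /\ e <= s /\ e <= eps / 2 /\ e <= r / 4).
      { unfold e. repeat split; [repeat apply Rmin_pos; lra| | |];
          unfold Rmin; repeat destruct Rle_dec; lra. }
      destruct (edge_near B (x p) e) as (N & u & HN & Hu1 & Hu2 & Hu3 & Hu4); [lra|].
      destruct (Hs2 (f N u)) as (x' & Hx1 & Hx2 & Hx3); [lra|].
      (* Only the parent could meet [u], and it now sits at [f N u <> u]. *)
      apply (admissible_snoc M par old B y eps lab x x' r (x p) N u p); auto; try lra.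
      * intros i Hi Hne. pose proof (Hs i p Hi Hp Hne). lra.
      * congruence.
      * pose proof (proj1 (proj2 Hadm) p Hp). pose proof (dist_tri (y M) (x p) u).
        rewrite HyM in *. lra.
      * intros j. rewrite E, Eo. intros [= <-]. auto.
  (* Root: the edge only provides two distinct points near [y M], one of which is free. The label 0
     is a default. *)
  - destruct (IH' (eps / 2)) as (lab & x & r & _ & Hadm & Hr & Hs); [lra..|].
    destruct (edge_near 0 (y M) (Rmin eps (r / 4))) as (N & u & _ & _ & Hu2 & Hu3 & Hu4);
      [apply Rmin_pos; lra|].
    pose proof (Rmin_l eps (r / 4)). pose proof (Rmin_r eps (r / 4)).
    destruct (separated_at_most_one_near M x r (y M) Hs) as [i0 Hi0].
    assert (Hw : exists w, x i0 <> w /\ d (y M) w < Rmin eps (r / 4)).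
    { destruct (avoid_one _ _ (x i0) Hu4); eauto. }
    destruct Hw as (w & Hw1 & Hw2).
    apply (admissible_snoc M par old B y eps lab x x r (y M) 0%nat w i0); auto; try lra.
    + apply Hadm.
    + intros i _. rewrite dist_refl. apply Rmin_pos; lra.
    + rewrite E. discriminate.
Qed.

Lemma uniform_radius M (P : nat -> R -> Prop) :
  (forall i r r', r' <= r -> P i r -> P i r') ->
  (forall i, (i < M)%nat -> exists r, 0 < r /\ P i r) ->
  exists r, 0 < r /\ forall i, (i < M)%nat -> P i r.
Proof.
  intros Hmono H. induction M as [|M IH]; [exists 1; split; [lra|lia]|].
  destruct IH as (r & Hr & HP).
  - intros i Hi. apply H. lia.
  - destruct (H M) as (s & Hs & HM); [lia|]. exists (Rmin r s). split; [now apply Rmin_pos|].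
    intros i Hi. destruct (Nat.eq_dec i M) as [->|].
    + apply Hmono with (2 := HM). apply Rmin_r.
    + apply Hmono with r; [apply Rmin_l|]. apply HP. lia.
Qed.

(** * The approximating maps *)

(** [label m a] is the index of the map [f] realizing the edge from [a] to [g m a]; [radius]
    controls later displacements. *)
Record stage := Stage {
  pt : cantor -> X;
  label : nat -> cantor -> nat;
  radius : R;
  label_bound : nat
}.

(** [label_incr] and [label_g] allow [Hcomp] to carry edges from a parent to its child. The factor 3
    in [radius_dom] exceeds the total later displacement, at most [2 * radius]. *)
Record good (n : nat) (s : stage) : Prop := {
  pt_type : forall a b, type n a = type n b -> pt s a = pt s b;
  label_type : forall m a b, (m < n)%nat -> type n a = type n b -> label s m a = label s m b;
  label_le : forall m a, (m < n)%nat -> (label s m a <= label_bound s)%nat;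
  label_incr : forall m k a, (m < k < n)%nat -> in_dom k a -> (label s m a < label s k a)%nat;
  label_g : forall m k a, (m < k < n)%nat -> in_dom k a -> label s m (g k a) = label s m a;
  pt_edge : forall m a, (m < n)%nat -> in_dom m a ->
    dom (label s m a) (pt s a) /\ f (label s m a) (pt s a) = pt s (g m a);
  radius_pos : 0 < radius s;
  radius_dom : forall m a z, (m < n)%nat -> in_dom m a -> d (pt s a) z < 3 * radius s ->
    dom (label s m a) z
}.

(** The factor 4 keeps two points apart when each still moves by at most [2 * radius s']. *)
Record refines (n : nat) (s s' : stage) : Prop := {
  radius_half : radius s' <= radius s / 2;
  pt_close : forall a, d (pt s a) (pt s' a) < radius s;
  label_keep : forall m a, (m < n)%nat -> label s' m a = label s m a;
  pt_separated : forall a b, type (S n) a <> type (S n) b ->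
    4 * radius s' < d (pt s' a) (pt s' b)
}.

Lemma edge_radius n (h : cantor -> X) (lam : nat -> cantor -> nat) :
  (forall a b, type n a = type n b -> h a = h b) ->
  (forall m a b, (m < n)%nat -> type n a = type n b -> lam m a = lam m b) ->
  (forall m a, (m < n)%nat -> in_dom m a -> dom (lam m a) (h a)) ->
  exists r, 0 < r /\ forall m a z, (m < n)%nat -> in_dom m a -> d (h a) z < 3 * r ->
    dom (lam m a) z.
Proof.
  intros Hh Hlam Hdom. destruct (type_bounded n) as [M HM].
  destruct (uniform_radius M (fun i r => forall m, (m < n)%nat ->
    forall a z, type n a = i -> in_dom m a -> d (h a) z < 3 * r -> dom (lam m a) z))
    as (r & Hr & H).
  - intros i r r' Hrr H m Hm a z Ha Hma Hz. apply (H m Hm a z); auto. lra.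
  - intros i _.
    apply uniform_radius with (P := fun m r => forall a z, type n a = i ->
      in_dom m a -> d (h a) z < 3 * r -> dom (lam m a) z).
    { intros m r r' Hrr H a z Ha Hma Hz. apply (H a z); auto. lra. }
    intros m Hm.
    destruct (classic (exists a, type n a = i /\ in_dom m a)) as [(a & Ha & Hma)|Hn].
    + destruct (Hf (lam m a)) as (Ho & _). destruct (Ho _ (Hdom m a Hm Hma)) as (r & Hr & H).
      exists (r / 3). split; [lra|]. intros b z Hb Hmb Hz. rewrite <- Ha in Hb.
      rewrite (Hlam m b a Hm Hb). apply H. rewrite <- (Hh b a Hb). lra.
    + exists 1. split; [lra|]. intros a z Ha Hma. exfalso. eauto.
  - exists r. split; auto. intros m a z Hm Hma Hz. now apply (H (type n a) (HM a) m Hm a).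
Qed.

Lemma good_0 (x0 : X) : good 0 (Stage (fun _ => x0) (fun _ _ => 0%nat) 1 0).
Proof. constructor; simpl; intros; auto; try lia; lra. Qed.

(** The vertices are the types of level [S n]. [config_extend] realizes the edges to parents, and
    [Hcomp] yields the other edges. *)
Lemma refine_step n s : good n s -> exists s', good (S n) s' /\ refines n s s'.
Proof.
  intros [H1 H2 H3 H4 H5 H6 H7 H8].
  destruct s as [h lam e B]; simpl in *.
  destruct (type_bounded (S n)) as [M HM].
  (* A representative of each type. Numbers that are not types get an arbitrary one, and [par] makes
     them roots. *)
  set (rep i := epsilon (inhabits (fun _ : nat => false)) (fun a => type (S n) a = i)).
  assert (Hrep : forall a, type (S n) (rep (type (S n) a)) = type (S n) a).
  { intros a. unfold rep. apply (epsilon_spec _ (fun b => type (S n) b = type (S n) a)). eauto. }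
  set (par i := if Nat.eq_dec (type (S n) (rep i)) i
    then match last_edge (S n) (rep i) with
         | Some k => Some (type (S n) (g k (rep i))) | None => None end
    else None).
  set (old i := match last_edge (S n) (rep i) with
    | Some k => if Nat.eq_dec k n then None else Some (lam k (rep i)) | None => None end).
  assert (Hpar : forall i j, par i = Some j -> exists k,
    last_edge (S n) (rep i) = Some k /\ j = type (S n) (g k (rep i)) /\ (j < i)%nat).
  { intros i j. unfold par. destruct (Nat.eq_dec (type (S n) (rep i)) i) as [Ei|]; [|discriminate].
    destruct (last_edge (S n) (rep i)) as [k|] eqn:E; [|discriminate]. intros [= <-].
    exists k. repeat split; auto. rewrite <- Ei at 2. now apply type_parent_lt. }
  destruct (config_extend M par old B (fun i => h (rep i)) e)
    as (lab & x & r & (Hc & Hcl & Hlab) & Hr & Hs); auto.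
  { intros i j E. destruct (Hpar i j E) as (? & _ & _ & ?). auto. }
  (* In the previous stage the ends of an edge [n] coincide by [type_g], and older edges already
     hold. *)
  { intros i j _ E. destruct (Hpar i j E) as (k & Ek & -> & _). unfold old. rewrite Ek.
    rewrite (H1 _ _ (type_S _ _ _ (Hrep (g k (rep i))))).
    destruct (last_edge_some _ _ _ Ek) as [Hk Hd].
    destruct (Nat.eq_dec k n) as [->|].
    - symmetry. apply H1, type_g.
    - apply H6; auto. lia. }
  set (h' a := x (type (S n) a)).
  set (lam' m a := if Nat.eq_dec m n then lab (type (S n) a) else lam m a).
  assert (Hold : forall m a, (m < n)%nat -> lam' m a = lam m a).
  { intros m a Hm. unfold lam'. destruct (Nat.eq_dec m n); auto. lia. }
  assert (Hlast : forall a k, last_edge (S n) a = Some k ->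
    dom (lam' k a) (h' a) /\ f (lam' k a) (h' a) = h' (g k a) /\ (k = n -> B < lam' n a)%nat).
  { intros a k E. destruct (type_eq_inv _ _ _ (Hrep a)) as [Ha Hg].
    assert (Ek : last_edge (S n) (rep (type (S n) a)) = Some k).
    { rewrite <- E. now apply last_edge_agree. }
    specialize (Hg k Ek).
    assert (Ep : par (type (S n) a) = Some (type (S n) (g k a))).
    { unfold par. rewrite Hrep, Ek, Hg. now destruct Nat.eq_dec. }
    specialize (Hlab _ _ (HM a) Ep). destruct (Hc _ _ (HM a) Ep) as [Hc1 Hc2].
    unfold old in Hlab. rewrite Ek in Hlab. unfold lam', h'.
    destruct (Nat.eq_dec n n) as [_|]; [|lia].
    destruct (Nat.eq_dec k n) as [->|Hkn]; auto.
    destruct (last_edge_some _ _ _ E) as [Hk _].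
    rewrite <- (H2 k _ a ltac:(lia) (type_S _ _ _ (Hrep a))), <- Hlab.
    repeat split; auto. lia. }
  assert (Hclose : forall a, d (h a) (h' a) < e).
  { intros a. rewrite <- (H1 _ _ (type_S _ _ _ (Hrep a))). apply Hcl, HM. }
  assert (Hinc : forall m k a, (m < k < S n)%nat -> in_dom k a -> (lam' m a < lam' k a)%nat).
  { intros m k a Hmk Ha. rewrite (Hold m) by lia. destruct (Nat.eq_dec k n) as [->|].
    (* Here the last edge is [n], whose label exceeds the bound [B] on the old labels. *)
    - destruct (last_edge_max (S n) a n) as (k & E & Hk); auto.
      assert (k = n) as -> by (apply last_edge_some in E; lia).
      destruct (Hlast a n E) as (_ & _ & Hb). specialize (Hb eq_refl).
      specialize (H3 m a). lia.
    - rewrite Hold by lia. apply H4; auto. lia. }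
  assert (Hlg : forall m k a, (m < k < S n)%nat -> in_dom k a -> lam' m (g k a) = lam' m a).
  { intros m k a Hmk Ha. rewrite !(Hold m) by lia. destruct (Nat.eq_dec k n) as [->|].
    - apply H2; [lia|]. apply type_g.
    - apply H5; auto. lia. }
  assert (Hedge : forall m a, (m < S n)%nat -> in_dom m a ->
    dom (lam' m a) (h' a) /\ f (lam' m a) (h' a) = h' (g m a)).
  { intros m a Hm. remember (type (S n) a) as N eqn:HN. revert a HN.
    induction N as [N IH] using lt_wf_ind. intros a -> Ha.
    destruct (last_edge_max (S n) a m Hm Ha) as (k & E & Hk).
    destruct (Hlast a k E) as (L1 & L2 & _). destruct (last_edge_some _ _ _ E) as [Hkn Hka].
    destruct (Nat.eq_dec m k) as [->|]; auto.
    (* The edge [m] at the parent [g k a] has the same label and, by [g_g], the same end; [Hcomp]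
       brings it back to [a]. *)
    assert (Hmk : (m < k < S n)%nat) by lia.
    destruct (IH _ (type_parent_lt _ _ _ E) (g k a) eq_refl) as [G1 G2].
    { apply in_dom_agree_lt with (n := k) (a := a); auto; [lia|]. apply agree_sym, g_prefix. }
    rewrite Hlg in G1, G2 by auto. rewrite g_g in G2 by lia.
    (* [Hcomp] asks for this membership; it holds because [h' a] is within the old radius of
       [h a]. *)
    assert (Hdm : dom (lam' m a) (h' a)).
    { rewrite Hold by lia. apply H8; auto; [lia|]. specialize (Hclose a). lra. }
    split; auto. rewrite <- G2, <- L2. symmetry. apply Hcomp; auto. now rewrite L2. }
  assert (Ht : forall m a b, (m < S n)%nat -> type (S n) a = type (S n) b -> lam' m a = lam' m b).
  { intros m a b Hm Hab. unfold lam'. destruct (Nat.eq_dec m n); [congruence|].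
    apply H2; [lia|]. now apply type_S. }
  destruct (edge_radius (S n) h' lam') as (e' & He' & Hd'); auto.
  { intros a b Hab. unfold h'. congruence. }
  { intros m a Hm Ha. now apply Hedge. }
  destruct (bounded_below lab M) as [B' HB'].
  (* The bounds serve, in order, the domains, the halving of the radius and the separation. *)
  assert (He : exists e0, 0 < e0 /\ e0 <= e' /\ e0 <= e / 2 /\ 4 * e0 <= r).
  { exists (Rmin e' (Rmin (e / 2) (r / 4))).
    repeat split; [repeat apply Rmin_pos; lra| | |];
      unfold Rmin; repeat destruct Rle_dec; lra. }
  destruct He as (e0 & E1 & E2 & E3 & E4).
  exists (Stage h' lam' e0 (Nat.max B B')). split; constructor; simpl; auto.
  - intros a b Hab. unfold h'. congruence.
  - intros m a Hm. unfold lam'. destruct (Nat.eq_dec m n).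
    + specialize (HB' _ (HM a)). lia.
    + specialize (H3 m a). lia.
  - intros m a z Hm Ha Hz. apply Hd'; auto. lra.
  - intros a b Hab. unfold h'. specialize (Hs _ _ (HM a) (HM b) Hab). lra.
Qed.

Lemma approximations (x0 : X) : exists st : nat -> stage,
  (forall n, good n (st n)) /\ forall n, refines n (st n) (st (S n)).
Proof.
  assert (Hstep : forall n (s : {s | good n s}),
    {s' : {s' | good (S n) s'} | refines n (proj1_sig s) (proj1_sig s')}).
  { intros n [s Hs]. apply constructive_indefinite_description.
    destruct (refine_step n s Hs) as (s' & Hg & Hr). exists (exist _ s' Hg). exact Hr. }
  set (st := nat_rect (fun n => {s | good n s}) (exist _ _ (good_0 x0))
    (fun n s => proj1_sig (Hstep n s))).
  exists (fun n => proj1_sig (st n)). split; intros n.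
  - exact (proj2_sig (st n)).
  - exact (proj2_sig (Hstep n (st n))).
Qed.

(** * The limit map *)

Context (Hcompl : complete_metric d).

Lemma embedding (x0 : X) : exists h : cantor -> X,
  (forall a b, h a = h b -> a = b) /\
  cantor_continuous d h /\
  (forall a b, G1 a b -> Af dom f (h a) (h b)).
Proof.
  destruct (approximations x0) as (st & Hg & Hr).
  assert (Hpos : forall n, 0 < radius (st n)) by (intros n; apply (Hg n)).
  (* The bound telescopes: by halving, [radius (st k)] is at most [2 * radius (st k) - 2 * radius
     (st (S k))]. *)
  assert (Hdist : forall n k a, (n <= k)%nat ->
    d (pt (st n) a) (pt (st k) a) <= 2 * radius (st n) - 2 * radius (st k)).
  { intros n k a Hk. induction Hk as [|k Hk IH]; [rewrite dist_refl; lra|].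
    pose proof (radius_half _ _ _ (Hr k)). pose proof (pt_close _ _ _ (Hr k) a).
    pose proof (dist_tri (pt (st n) a) (pt (st k) a) (pt (st (S k)) a)). lra. }
  assert (Hsmall : forall eps, 0 < eps -> exists n, radius (st n) < eps).
  { intros eps He. assert (Hp : forall n, radius (st n) <= radius (st 0%nat) * (1 / 2) ^ n).
    { induction n as [|n IH]; simpl; [lra|]. pose proof (radius_half _ _ _ (Hr n)). lra. }
    pose proof (Hpos 0%nat) as H0.
    destruct (pow_lt_1_zero (1 / 2)) with (y := eps / radius (st 0%nat)) as [N HN].
    - rewrite Rabs_pos_eq; lra.
    - now apply Rdiv_lt_0_compat.
    - exists N. specialize (HN N (le_n N)). specialize (Hp N).
      rewrite Rabs_pos_eq in HN by (apply pow_le; lra).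
      apply (Rmult_lt_compat_l (radius (st 0%nat))) in HN; auto.
      replace (radius (st 0%nat) * (eps / radius (st 0%nat))) with eps in HN by (field; lra).
      lra. }
  assert (Hlim : forall a, exists x, converges_to d (fun n => pt (st n) a) x).
  { intros a. apply Hcompl. intros eps He. destruct (Hsmall (eps / 4)) as [N HN]; [lra|].
    exists N. intros m n Hm Hn. pose proof (Hdist N m a Hm). pose proof (Hdist N n a Hn).
    pose proof (dist_tri (pt (st m) a) (pt (st N) a) (pt (st n) a)) as H1.
    rewrite (dist_sym (pt (st m) a) (pt (st N) a)) in H1.
    pose proof (Hpos m). pose proof (Hpos n). lra. }
  pose (h a := proj1_sig (constructive_indefinite_description _ (Hlim a))).
  assert (Hh : forall a, converges_to d (fun n => pt (st n) a) (h a)).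
  { intros a. exact (proj2_sig (constructive_indefinite_description _ (Hlim a))). }
  clearbody h.
  assert (Hnear : forall n a, d (pt (st n) a) (h a) <= 2 * radius (st n)).
  { intros n a. apply Rnot_lt_le. intros Hlt.
    destruct (Hh a (d (pt (st n) a) (h a) - 2 * radius (st n))) as [N HN]; [lra|].
    specialize (HN (Nat.max n N) ltac:(lia)). pose proof (Hdist n (Nat.max n N) a ltac:(lia)).
    pose proof (dist_tri (pt (st n) a) (pt (st (Nat.max n N)) a) (h a)).
    pose proof (Hpos (Nat.max n N)). lra. }
  exists h. split; [|split].
  - intros a b Hab. apply functional_extensionality. intros k. apply NNPP. intros Hk.
    (* Position [k] lies in the prefix of length [2 ^ q (S k)] recorded by the type. *)
    assert (Ht : type (S k) a <> type (S k) b).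
    { intros Ht. apply type_eq_inv in Ht as [Ht _]. apply Hk, Ht.
      pose proof (q_ge (S k)). pose proof (Nat.pow_gt_lin_r 2 (q (S k))). lia. }
    pose proof (pt_separated _ _ _ (Hr k) a b Ht).
    pose proof (Hnear (S k) a). pose proof (Hnear (S k) b) as H1. rewrite <- Hab in H1.
    pose proof (dist_tri (pt (st (S k)) a) (h a) (pt (st (S k)) b)) as H2.
    rewrite (dist_sym (h a)) in H2. lra.
  (* Stage [n] is locally constant and within [eps / 2] of [h]. *)
  - intros a eps He. destruct (Hsmall (eps / 4)) as [n Hn]; [lra|].
    destruct (type_locally_constant n) as [l Hl]. exists l. intros b Hb.
    pose proof (pt_type _ _ (Hg n) _ _ (Hl _ _ Hb)) as E.
    pose proof (Hnear n a) as Ha. pose proof (Hnear n b) as Hb'. rewrite E in Hb'.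
    pose proof (dist_tri (h a) (pt (st n) a) (h b)) as H1.
    rewrite (dist_sym (h a) (pt (st n) a)) in H1. lra.
  - intros a b (m & Ha & ->).
    (* The label of an edge [m] is settled at stage [S m], the first to contain it. *)
    assert (Hlab : forall k, (m < k)%nat -> label (st k) m a = label (st (S m)) m a).
    { intros k Hk. induction Hk as [|k Hk IH]; auto.
      rewrite (label_keep _ _ _ (Hr k)); auto. }
    set (l := label (st (S m)) m a) in *. exists l.
    assert (Hdom : dom l (h a)).
    { apply (radius_dom _ _ (Hg (S m)) m a); auto.
      pose proof (Hnear (S m) a). pose proof (Hpos (S m)). lra. }
    split; auto. apply NNPP. intros Hne.
    pose proof (dist_pos _ _ Hne) as Hp.
    (* The edge holds exactly at late stages, whose two ends come within half of the supposed gap of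
       [f l (h a)] and [h (g m a)]. *)
    destruct (continuous_at l (h a) (d (f l (h a)) (h (g m a)) / 2)) as (s & Hs1 & Hs2);
      auto; [lra|].
    destruct (Hh a s Hs1) as [N1 HN1].
    destruct (Hh (g m a) (d (f l (h a)) (h (g m a)) / 2)) as [N2 HN2]; [lra|].
    set (k := Nat.max (S m) (Nat.max N1 N2)).
    specialize (HN1 k ltac:(lia)). specialize (HN2 k ltac:(lia)).
    rewrite dist_sym in HN1. destruct (Hs2 _ HN1) as [_ Hv].
    destruct (pt_edge _ _ (Hg k) m a) as [_ He]; [lia|auto|].
    rewrite Hlab in He by lia. rewrite He in Hv.
    pose proof (dist_tri (f l (h a)) (pt (st k) (g m a)) (h (g m a))). lra.
Qed.

End Situation.

Theorem theorem1p8 (X : Type) (d : X -> X -> R)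
  (dom : nat -> X -> Prop) (f : nat -> X -> X) :
  complex_situation d dom f ->
  (forall (m n : nat) (x : X), (m < n)%nat ->
     dom n x -> dom m (f n x) -> dom m x -> f m (f n x) = f m x) ->
  exists h : cantor -> X,
    (forall a b, h a = h b -> a = b) /\
    cantor_continuous d h /\
    (forall a b, G1 a b -> Af dom f (h a) (h b)).
Proof.
  intros ([x0] & (Hmet & Hcompl & _) & Hf & Hirr & Hdiag) Hcomp.
  now apply embedding.
Qed.
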